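(* Let $x,y$ be independent indeterminates and let $i_1,i_2,i_3,j_1,j_2,j_3\in\mathbb Z_{\ge0}$ satisfy the balance condition $i_1+j_2+j_3=i_2+i_3+j_1$. Consider the Yang--Baxter equation \[ \sum_{k_1,k_2,k_3\ge0}\mathbb R_{x,y}(i_2,i_1;k_2,k_1)\,W_x(k_3,k_2;j_3,j_2)\,W^*_y(i_3,k_1;k_3,j_1)=\sum_{k_1',k_2',k_3'\ge0}W_x(i_3,i_2;k_3',k_2')\,W^*_y(k_3',i_1;j_3,k_1')\,\mathbb R_{x,y}(k_2',k_1';j_2,j_1), \] in which arrow conservation leaves one free internal coordinate on each side: \[ (k_1,k_2,k_3)=(k_1,\;i_2+k_1-i_1,\;i_3+j_1-k_1),\qquad (k_1',k_2',k_3')=(k_1',\;k_1'+j_2-j_1,\;j_3+i_1-k_1'). \] Then: (1) The summands on the left- and right-hand sides are, respectively, \[ x^{j_2}y^{j_1}(xy)^{\min(k_1,k_2)}\qquad\text{and}\qquad x^{k_2'}y^{k_1'}(xy)^{\min(j_1,j_2)}, \] and they are nonzero exactly for $k_1$, respectively $k_1'$, in the integer intervals \[ \max(0,i_1-i_2)\le k_1\le\min(i_3,\,i_3+j_1-j_2),\qquad \max(0,j_1-j_2)\le k_1'\le\min(j_3,\,j_3+i_1-i_2) \] (that is, inside these intervals the summands are the displayed monomials, and outside they vanish). The two intervals contain the same number of integer points. (2) The map \[ k_1'=j_1-\min(j_1,j_2)+\min(k_1,k_2)=k_1+\max(0,j_1-j_2)-\max(0,i_1-i_2) \] is a weight-preserving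 bijection from the first interval to the second: the left summand at $k_1$ equals the right summand at $k_1'$. (3) It is the only weight-preserving bijection between the two intervals: within each of the two lists of summands the monomials are pairwise distinct.
   Context: All arguments of the weights are nonnegative integers. The weights are \[ W_x(i_1,j_1;i_2,j_2)=\mathbf 1_{i_1+j_1=i_2+j_2}\,\mathbf 1_{i_1\ge j_2}\,x^{j_2},\qquad W^*_y(i_1,j_1;i_2,j_2)=\mathbf 1_{i_2+j_1=i_1+j_2}\,\mathbf 1_{i_2\ge j_2}\,y^{j_2}, \] \[ \mathbb R_{x,y}(i_1,j_1;i_2,j_2)=\mathbf 1_{i_1+j_2=j_1+i_2}\,(xy)^{\min(i_2,j_2)}, \] where $\mathbf 1$ denotes the indicator (1 if the condition holds, 0 otherwise). A weight is regarded as $0$ if one of its arguments would be negative. *)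

(* Defs.v *)
From mathcomp Require Import all_boot all_order all_algebra finmap zify.
From mathcomp Require Import mpoly.
Set Implicit Arguments. Unset Strict Implicit. Unset Printing Implicit Defensive.
Import Order.TTheory GRing.Theory Num.Theory.
Local Open Scope ring_scope.

Definition weight_W (A : comNzRingType) (x : A) (i1 j1 i2 j2 : nat) : A :=
  (i1 + j1 == i2 + j2)%N%:R * (j2 <= i1)%N%:R * x ^+ j2.

Definition weight_Wstar (A : comNzRingType) (y : A) (i1 j1 i2 j2 : nat) : A :=
  (i2 + j1 == i1 + j2)%N%:R * (j2 <= i2)%N%:R * y ^+ j2.

Definition weight_R (A : comNzRingType) (x y : A) (i1 j1 i2 j2 : nat) : A :=
  (i1 + j2 == j1 + i2)%N%:R * (x * y) ^+ minn i2 j2.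

(* Internal coordinates forced by conservation are differences, so a weight   *)
(* is evaluated at integers: it is 0 as soon as one argument is negative.     *)
Definition extend0 (A : comNzRingType) (w : nat -> nat -> nat -> nat -> A)
    (i1 j1 i2 j2 : int) : A :=
  match i1, j1, i2, j2 with
  | Posz a, Posz b, Posz c, Posz d => w a b c d
  | _, _, _, _ => 0
  end.

Definition YB_left_summand (A : comNzRingType) (x y : A)
    (i1 i2 i3 j1 j2 j3 k1 k2 k3 : int) : A :=
  extend0 (weight_R x y) i2 i1 k2 k1 * extend0 (weight_W x) k3 k2 j3 j2
    * extend0 (weight_Wstar y) i3 k1 k3 j1.

Definition YB_right_summand (A : comNzRingType) (x y : A)
    (i1 i2 i3 j1 j2 j3 k1 k2 k3 : int) : A :=
  extend0 (weight_W x) i3 i2 k3 k2 * extend0 (weight_Wstar y) k3 i1 j3 k1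
    * extend0 (weight_R x y) k2 k1 j2 j1.

(* Empty when b < a.                                                          *)
Definition int_range (a b : int) : {fset int} :=
  [fset (a + n%:Z)%R | n in iota 0 (absz (Num.max 0 (b - a + 1))%R)]%fset.

Lemma in_int_range (a b k : int) : (k \in int_range a b) = (a <= k <= b).
Proof.
apply/imfsetP/idP => /= [[n + ->]|ab]; rewrite ?mem_iota; first by lia.
by exists `|k - a|%N; rewrite /= ?mem_iota; lia.
Qed.

(* Main.v *)
(* At nonnegative integers each summand is an indicator times a monomial in x *)
(* and y, so membership in the interval amounts to linear arithmetic. The     *)
(* exponent of x is j2 + min (k1, k2) on the left, that of y is               *)
(* k1' + min (j1, j2) on the right; both are injective in the free            *)
(* coordinate, since k2 - k1 and k2' - k1' are constant. Hence a              *)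
(* weight-preserving map between the intervals is unique, and the balance     *)
(* condition shows that the translation in (2) is one.                        *)
Require Import Defs.
From mathcomp Require Import all_boot all_order all_algebra finmap.
From mathcomp Require Import mpoly zify ring.
Set Implicit Arguments. Unset Strict Implicit. Unset Printing Implicit Defensive.
Import Order.TTheory GRing.Theory Num.Theory.
Local Open Scope ring_scope.

(** With [m = min(k1,k2)] and [n = min(j1,j2)], a nonzero summand is [x^(j2+m) y^(j1+m)] on the left
    and [x^(k2'+n) y^(k1'+n)] on the right. Since [k2' - k1' = j2 - j1], the two agree as soon as
    the exponents of [y] do, that is for [k1' = j1 - n + m]; and [m = k1 - max(0,i1-i2)] makes this
    a translation. It matches the lower endpoints of the intervals by inspection and the upper ones
    by balance. [YB_left_summandE] and [YB_right_summandE] give the supports, [mulXnXn_inj] the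
    distinctness of the monomials, which forces the bijection. *)

Lemma YB_left_summandE (A : comNzRingType) (x y : A)
    (i1 i2 i3 j1 j2 j3 m1 m2 m3 : nat) :
  YB_left_summand x y i1 i2 i3 j1 j2 j3 m1 m2 m3 =
  [&& i2 + m1 == i1 + m2, m3 + m2 == j3 + j2, j2 <= m3, m3 + m1 == i3 + j1
    & j1 <= m3]%N%:R * (x ^+ j2 * y ^+ j1 * (x * y) ^+ minn m1 m2).
Proof.
rewrite /YB_left_summand /= /weight_R /weight_W /weight_Wstar minnC.
rewrite -!mulnb !natrM.
by ring.
Qed.

Lemma YB_right_summandE (A : comNzRingType) (x y : A)
    (i1 i2 i3 j1 j2 j3 m1 m2 m3 : nat) :
  YB_right_summand x y i1 i2 i3 j1 j2 j3 m1 m2 m3 =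
  [&& i3 + i2 == m3 + m2, m2 <= i3, j3 + i1 == m3 + m1, m1 <= j3
    & m2 + j1 == m1 + j2]%N%:R * (x ^+ m2 * y ^+ m1 * (x * y) ^+ minn j1 j2).
Proof.
rewrite /YB_right_summand /= /weight_R /weight_W /weight_Wstar minnC.
rewrite -!mulnb !natrM.
by ring.
Qed.

(** The coefficient at [m1] is 1 on one side and the indicator of [m2 = m1] on the other, and 1 is
    not 0 in [R]. *)
Lemma mpolyX_inj (n : nat) (R : nzRingType) : injective (@mpolyX n R).
Proof.
move=> m1 m2 /(congr1 (mcoeff m1)) /eqP; rewrite !mcoeffX eqxx /=.
by case: (m2 =P m1) => // _; rewrite oner_eq0.
Qed.

Lemma mpolyX_neq0 (n : nat) (R : nzRingType) (m : 'X_{1.. n}) :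
  'X_[R, m] != 0.
Proof.
apply/eqP => /(congr1 (mcoeff m)) /eqP.
by rewrite mcoeffX mcoeff0 eqxx oner_eq0.
Qed.

Section TwoVariables.
Variables (n : nat) (K : comNzRingType) (i j : 'I_n).
Implicit Types a b c d e : nat.
Local Notation x := ('X_i : {mpoly K[n]}).
Local Notation y := ('X_j : {mpoly K[n]}).

Lemma mulXnXnE a b : x ^+ a * y ^+ b = 'X_[(U_(i) *+ a + U_(j) *+ b)].
Proof. by rewrite !mpolyXn mpolyXD. Qed.

Lemma mulXnXn_exp a b e :
  x ^+ a * y ^+ b * (x * y) ^+ e = x ^+ (a + e) * y ^+ (b + e).
Proof. by rewrite exprMn mulrACA -!exprD. Qed.

Lemma mulXnXn_neq0 a b : x ^+ a * y ^+ b != 0.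
Proof. by rewrite mulXnXnE mpolyX_neq0. Qed.

(** Coordinates [i] and [j] of the exponent multi-index recover the two powers; [i != j] removes the
    cross terms. *)
Lemma mulXnXn_inj a b c d : i != j ->
  x ^+ a * y ^+ b = x ^+ c * y ^+ d -> a = c /\ b = d.
Proof.
move=> neq_ij; rewrite !mulXnXnE => /mpolyX_inj eq_m.
have := congr1 (fun m : 'X_{1.. n} => m i) eq_m.
have := congr1 (fun m : 'X_{1.. n} => m j) eq_m.
rewrite /= !mnmDE !mulmnE !mnm1E !eqxx (negPf neq_ij) eq_sym (negPf neq_ij).
by rewrite !mul1n !mul0n !addn0.
Qed.

End TwoVariables.

Lemma card_int_range (a b : int) :
  #|` int_range a b|%fset = absz (Num.max 0 (b - a + 1)).
Proof.
rewrite /int_range card_imfset /=; last by move=> m n; lia.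
by rewrite undup_id ?iota_uniq // size_iota.
Qed.

Theorem lemma3p2 (K : comNzRingType) (i1 i2 i3 j1 j2 j3 : nat)
    (balance : (i1 + j2 + j3 = i2 + i3 + j1)%N) :
  let x : {mpoly K[2]} := 'X_ord0 in
  let y : {mpoly K[2]} := 'X_ord_max in
  let k2 (k1 : int) : int := i2%:Z + k1 - i1%:Z in
  let k3 (k1 : int) : int := i3%:Z + j1%:Z - k1 in
  let k2' (k1' : int) : int := k1' + j2%:Z - j1%:Z in
  let k3' (k1' : int) : int := j3%:Z + i1%:Z - k1' in
  let left_at (k1 : int) : {mpoly K[2]} :=
    YB_left_summand x y i1 i2 i3 j1 j2 j3 k1 (k2 k1) (k3 k1) in
  let right_at (k1' : int) : {mpoly K[2]} :=
    YB_right_summand x y i1 i2 i3 j1 j2 j3 k1' (k2' k1') (k3' k1') in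
  let I : {fset int} :=
    int_range (Num.max 0 (i1%:Z - i2%:Z))
              (Num.min i3%:Z (i3%:Z + j1%:Z - j2%:Z)) in
  let I' : {fset int} :=
    int_range (Num.max 0 (j1%:Z - j2%:Z))
              (Num.min j3%:Z (j3%:Z + i1%:Z - i2%:Z)) in
  (* arrow conservation: one free internal coordinate on each side *)
  ((forall m1 m2 m3 : nat,
      YB_left_summand x y i1 i2 i3 j1 j2 j3 m1 m2 m3 != 0 ->
      m2%:Z = k2 m1 /\ m3%:Z = k3 m1) /\
   (forall m1 m2 m3 : nat,
      YB_right_summand x y i1 i2 i3 j1 j2 j3 m1 m2 m3 != 0 ->
      m2%:Z = k2' m1 /\ m3%:Z = k3' m1)) /\
  (* (1) *)
  ((forall k1 : int, k1 \in I ->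
      [/\ 0 <= k1, 0 <= k2 k1, 0 <= k3 k1,
          left_at k1
            = x ^+ j2 * y ^+ j1 * (x * y) ^+ `|Num.min k1 (k2 k1)|%N
        & left_at k1 != 0]) /\
   (forall k1 : int, k1 \notin I -> left_at k1 = 0) /\
   (forall k1' : int, k1' \in I' ->
      [/\ 0 <= k1', 0 <= k2' k1', 0 <= k3' k1',
          right_at k1'
            = x ^+ `|k2' k1'|%N * y ^+ `|k1'|%N * (x * y) ^+ minn j1 j2
        & right_at k1' != 0]) /\
   (forall k1' : int, k1' \notin I' -> right_at k1' = 0) /\
   #|` I| = #|` I'|) /\
  (* (2) and (3) *)
  (exists f : I -> I',
     [/\ forall k1 : I,
           val (f k1) = j1%:Z - Num.min j1%:Z j2%:Z
                        + Num.min (val k1) (k2 (val k1)) /\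
           val (f k1) = val k1 + Num.max 0 (j1%:Z - j2%:Z)
                        - Num.max 0 (i1%:Z - i2%:Z),
         bijective f,
         forall k1 : I, left_at (val k1) = right_at (val (f k1))
       & forall g : I -> I', bijective g ->
           (forall k1 : I, left_at (val k1) = right_at (val (g k1))) ->
           g =1 f]) /\
  {in I &, injective left_at} /\ {in I' &, injective right_at}.
Proof.
move=> x y k2 k3 k2' k3' left_at right_at I I'.
have neq01 : ord0 != ord_max :> 'I_2 by [].
have left_in k : k \in I -> [/\ 0 <= k, 0 <= k2 k, 0 <= k3 k
    & left_at k = x ^+ j2 * y ^+ j1 * (x * y) ^+ `|Num.min k (k2 k)|%N].
  rewrite in_int_range => k_in.
  have [k_ge0 k2_ge0 k3_ge0] : [/\ 0 <= k, 0 <= k2 k & 0 <= k3 k].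
    by rewrite /k2 /k3; split; lia.
  split=> //; rewrite /left_at.
  (* [extend0] reduces only on constructors of [int], so the nonnegative coordinates are first
     replaced by naturals. *)
  have [m1 E1 [m2 E2 [m3 E3]]] : exists2 m1 : nat, k = m1 &
      exists2 m2 : nat, k2 k = m2 & exists m3 : nat, k3 k = m3.
    by exists `|k|%N; [lia | exists `|k2 k|%N; [lia | exists `|k3 k|%N; lia]].
  rewrite E2 E3 E1 YB_left_summandE; move: E2 E3; rewrite /k2 /k3 => E2 E3.
  have -> : [&& i2 + m1 == i1 + m2, m3 + m2 == j3 + j2, j2 <= m3,
    m3 + m1 == i3 + j1 & j1 <= m3]%N by lia.
  by rewrite mul1r; congr (_ * _ ^+ _); lia.
have left_out k : k \notin I -> left_at k = 0.
  rewrite in_int_range /left_at => k_out.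
  (* A negative coordinate makes some factor 0 through [extend0]; if all three are naturals, some
     indicator fails off the interval. *)
  case E1: k (k2 k) (erefl (k2 k)) (k3 k) (erefl (k3 k)) => [m1|m1] [m2|m2] E2
    [m3|m3] E3; try by rewrite /YB_left_summand /= ?(mul0r, mulr0).
  rewrite YB_left_summandE; move: E2 E3; rewrite /k2 /k3 => E2 E3.
  by rewrite [X in nat_of_bool X](_ : _ = false) ?mul0r //; lia.
have right_in k : k \in I' -> [/\ 0 <= k, 0 <= k2' k, 0 <= k3' k
    & right_at k = x ^+ `|k2' k|%N * y ^+ `|k|%N * (x * y) ^+ minn j1 j2].
  rewrite in_int_range => k_in.
  have [k_ge0 k2_ge0 k3_ge0] : [/\ 0 <= k, 0 <= k2' k & 0 <= k3' k].
    by rewrite /k2' /k3'; split; lia.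
  split=> //; rewrite /right_at.
  have [m1 E1 [m2 E2 [m3 E3]]] : exists2 m1 : nat, k = m1 &
      exists2 m2 : nat, k2' k = m2 & exists m3 : nat, k3' k = m3.
    by exists `|k|%N; [lia | exists `|k2' k|%N; [lia | exists `|k3' k|%N; lia]].
  rewrite E2 E3 E1 YB_right_summandE; move: E2 E3; rewrite /k2' /k3' => E2 E3.
  have -> : [&& i3 + i2 == m3 + m2, m2 <= i3, j3 + i1 == m3 + m1, m1 <= j3
    & m2 + j1 == m1 + j2]%N by lia.
  by rewrite mul1r.
have right_out k : k \notin I' -> right_at k = 0.
  rewrite in_int_range /right_at => k_out.
  case E1: k (k2' k) (erefl (k2' k)) (k3' k) (erefl (k3' k)) => [m1|m1] [m2|m2]
    E2 [m3|m3] E3; try by rewrite /YB_right_summand /= ?(mul0r, mulr0).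
  rewrite YB_right_summandE; move: E2 E3; rewrite /k2' /k3' => E2 E3.
  by rewrite [X in nat_of_bool X](_ : _ = false) ?mul0r //; lia.
have left_inj : {in I &, injective left_at}.
  move=> k l k_in l_in.
  have [k_ge0 k2_ge0 _ ->] := left_in k k_in.
  have [l_ge0 l2_ge0 _ ->] := left_in l l_in.
  rewrite !mulXnXn_exp => /(mulXnXn_inj neq01)[].
  by move: k2_ge0 l2_ge0; rewrite /k2; lia.
have right_inj : {in I' &, injective right_at}.
  move=> k l k_in l_in.
  have [k_ge0 k2_ge0 _ ->] := right_in k k_in.
  have [l_ge0 l2_ge0 _ ->] := right_in l l_in.
  by rewrite !mulXnXn_exp => /(mulXnXn_inj neq01)[_]; lia.
(* Solves [j1 + min(k1,k2) = k1' + min(j1,j2)] for [k1' - k1]. *)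
pose shift : int := Num.max 0 (j1%:Z - j2%:Z) - Num.max 0 (i1%:Z - i2%:Z).
(* Balance gives [i3 + j1 - j2 = j3 + i1 - i2], which aligns the upper endpoints. Being an
   equivalence, this yields both [f] and its inverse. *)
have shift_in k : (k + shift \in I') = (k \in I).
  by rewrite !in_int_range /shift; lia.
have weight_shift k : k \in I -> left_at k = right_at (k + shift).
  move=> k_in; have [k_ge0 k2_ge0 _ ->] := left_in k k_in.
  have [|l_ge0 l2_ge0 _ ->] := right_in (k + shift); first by rewrite shift_in.
  rewrite !mulXnXn_exp; move: k2_ge0 l2_ge0; rewrite /k2 /k2' /shift.
  by move=> k2_ge0 l2_ge0; congr (_ ^+ _ * _ ^+ _); lia.
have shiftP (k : I) : val k + shift \in I' by rewrite shift_in (valP k).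
have unshiftP (k : I') : val k - shift \in I by rewrite -shift_in subrK (valP k).
pose f (k : I) : I' := FSetSub (shiftP k).
have f_weight (k : I) : left_at (val k) = right_at (val (f k)).
  exact: weight_shift (valP k).
split; first split.
(* A nonzero summand has a true indicator, whose conservation equalities determine [m2] and [m3]
   from [m1]. *)
- move=> m1 m2 m3; rewrite YB_left_summandE; case: andP => [|_]; last first.
    by rewrite mul0r eqxx.
  by rewrite /k2 /k3; lia.
- move=> m1 m2 m3; rewrite YB_right_summandE; case: andP => [|_]; last first.
    by rewrite mul0r eqxx.
  by rewrite /k2' /k3'; lia.
split.
  split.
    move=> k /[dup] k_in /left_in[k_ge0 k2_ge0 k3_ge0 E]; split=> //.
    by rewrite E mulXnXn_exp mulXnXn_neq0.
  split=> //; split.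
    move=> k /[dup] k_in /right_in[k_ge0 k2_ge0 k3_ge0 E]; split=> //.
    by rewrite E mulXnXn_exp mulXnXn_neq0.
  by split=> //; rewrite !card_int_range; lia.
split=> //; exists f; split=> //.
- move=> k; rewrite /f /= /k2 /shift; have := valP k; rewrite in_int_range.
  by split; lia.
- exists (fun k => FSetSub (unshiftP k)) => k; apply: val_inj => /=.
    by rewrite addrK.
  by rewrite subrK.
(* The right summands at [g k] and [f k] both equal the left summand at [k], so [right_inj]
   identifies the two points. *)
- move=> g _ g_weight k; apply/val_inj/right_inj;
    rewrite ?(valP (g k)) ?shiftP //.
  by rewrite -g_weight -f_weight.
Qed.
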